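(* Let $P$ be a Dedekind Poisson algebra over an arbitrary field $F$, and let $P(+,\cdot)=E\oplus N$ be its idempotent--nil decomposition (described in the context). Then $N$ is a Poisson ideal of $P$ and $$[P,P]=[N,N]\subseteq N^2.$$
   Context: A Poisson algebra over a field $F$ is an $F$-vector space $P$ with a bilinear commutative associative multiplication $xy$ (no identity element is assumed) and an alternating Lie bracket $[\,,\,]$ ($[x,x]=0$ for all $x$) satisfying $[xy,z]=x[y,z]+y[x,z]$. A Poisson subalgebra is a subspace closed under both operations; a Poisson ideal is a subspace $I$ with $PI\subseteq I$ and $[P,I]\subseteq I$. A Poisson algebra is Dedekind if every Poisson subalgebra is a Poisson ideal. No finite-dimensionality is assumed. $P(+,\cdot)$ denotes $P$ as a commutative associative algebra. Idempotent--nil decomposition of a Dedekind Poisson algebra $P$: $P(+,\cdot)$ has at most one non-zero idempotent. If it has none, $E=0$ and $N=P$; if $e$ is the non-zero idempotent, $E=Fe$ and $N=\{x\in P: ex=0\}$. One has $P(+,\cdot)=E\oplus N$ as a direct sum of associative ideals, $EN=0$, $N^3=0$, $\dim_FN^2\le1$ (in particular all elements of $N$ are nilpotent). Here $N^2$ is the linear span of products of two elements of $N$, $N^3=N^2N$, and $[A,B]$ denotes the linear span of all $[a,b]$, $a\in A$, $b\in B$. *)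

(* Defs.v *)
From HB Require Import structures.
From mathcomp Require Import all_boot all_algebra.
From mathcomp Require Import boolp classical_sets.
Set Implicit Arguments.
Unset Strict Implicit.
Unset Printing Implicit Defensive.

Import GRing.Theory.
Local Open Scope classical_set_scope.
Local Open Scope ring_scope.

(* The product is a plain operation on an F-module rather than a ring
   multiplication because no identity element is assumed. *)
HB.mixin Record Lmodule_isPoisson (F : fieldType) P of GRing.Lmodule F P := {
  pmul : P -> P -> P;
  pbracket : P -> P -> P;
  pmul_bilinear : bilinear_for *:%R *:%R pmul;
  pmulC : commutative pmul;
  pmulA : associative pmul;
  pbracket_bilinear : bilinear_for *:%R *:%R pbracket;
  pbracketxx : forall x, pbracket x x = 0;
  pjacobi : forall x y z,
    pbracket x (pbracket y z) + pbracket y (pbracket z x)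
      + pbracket z (pbracket x y) = 0;
  pleibniz : forall x y z,
    pbracket (pmul x y) z = pmul x (pbracket y z) + pmul y (pbracket x z)
}.

#[short(type="poissonType")]
HB.structure Definition Poisson (F : fieldType) :=
  {P of GRing.Lmodule F P & Lmodule_isPoisson F P}.

Definition subspace (F : fieldType) (V : lmodType F) (A : set V) : Prop :=
  GRing.submod_closed (mem A).

Definition linear_span (F : fieldType) (V : lmodType F) (A : set V) : set V :=
  smallest (@subspace F V) A.

Section PoissonAlgebra.
Variables (F : fieldType) (P : poissonType F).
Implicit Types (A B S I E N : set P) (e : P).

Definition pmul_span A B : set P :=
  linear_span [set pmul a b | a in A & b in B].

Definition pbracket_span A B : set P :=
  linear_span [set pbracket a b | a in A & b in B].

Definition poisson_subalgebra S : Prop :=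
  [/\ subspace S,
      forall x y, S x -> S y -> S (pmul x y) &
      forall x y, S x -> S y -> S (pbracket x y)].

Definition poisson_ideal I : Prop :=
  [/\ subspace I,
      forall x y, I y -> I (pmul x y) &
      forall x y, I y -> I (pbracket x y)].

Definition nonzero_idempotent e : Prop := e <> 0 /\ pmul e e = e.

(* When P is Dedekind the non-zero idempotent is unique if it exists, so this
   determines E and N. *)
Definition idempotent_nil_decomposition E N : Prop :=
  ((forall e, ~ nonzero_idempotent e) /\ E = [set 0] /\ N = setT)
  \/ (exists e, [/\ nonzero_idempotent e,
                    E = [set x | exists a : F, x = a *: e] &
                    N = [set x | pmul e x = 0]]).

End PoissonAlgebra.

Definition dedekind (F : fieldType) (P : poissonType F) : Prop :=
  forall S : set P, poisson_subalgebra S -> poisson_ideal S.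

(* Main.v *)
Require Import Defs.
From HB Require Import structures.
From mathcomp Require Import all_boot all_algebra.
From mathcomp Require Import boolp classical_sets.

(** In a Dedekind Poisson algebra the brackets of [N] are seen modulo [N^2].
   There the product vanishes, so for [x] in [N] the subspace [Fx + N^2] is a
   Poisson subalgebra, hence a Poisson ideal: every line of the Lie algebra
   [N / N^2] is a Lie ideal.  Such a Lie algebra is abelian, for the bracket of
   [x] and [y] is both [a x] and [b y], and if [a] is non-zero then bracketing
   [a x = b y] with [y] gives [a [x, y] = b [y, y] = 0].  This is
   [dedekind_bracket_in_square], valid for every Poisson ideal [N].

   If [P] has a non-zero idempotent [e], then [Fe] is a Poisson ideal, so
   [[e, y] = c e], while the Leibniz rule at [e = e e] gives [c e = 2 c e];
   thus [e] is Lie-central ([dedekind_idempotent_central]).  Consequently the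
   annihilator [N] of [e] is a Poisson ideal, and replacing [x] and [y] by
   their components in [N] does not change [[x, y]]. *)

Set Implicit Arguments.
Unset Strict Implicit.
Unset Printing Implicit Defensive.

Import GRing.Theory.
Local Open Scope classical_set_scope.
Local Open Scope ring_scope.

Section Subspaces.
Variables (F : fieldType) (V : lmodType F).
Implicit Types (A B : set V) (u v : V).

Lemma subspaceP A :
  subspace A <-> A 0 /\ forall a u v, A u -> A v -> A (a *: u + v).
Proof.
split=> [[A0 Alin]|[A0 Alin]].
  split; first by move: A0; rewrite inE.
  by move=> a u v Au Av; have := Alin a u v; rewrite !inE; apply.
by split=> [|a u v]; rewrite !inE //; apply: Alin.
Qed.

Lemma subspaceD A u v : subspace A -> A u -> A v -> A (u + v).
Proof.
by move=> /subspaceP[_ Alin] Au Av; rewrite -[u]scale1r; apply: Alin.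
Qed.

Lemma subspaceZ A a u : subspace A -> A u -> A (a *: u).
Proof.
by move=> /subspaceP[A0 Alin] Au; rewrite -[a *: u]addr0; apply: Alin.
Qed.

Lemma subspace_linear_span A : subspace (linear_span A).
Proof.
apply/subspaceP; split=> [B [/subspaceP[]]//|a u v Au Av B [sB AB]].
have /subspaceP[_ Blin] := sB.
by apply: Blin; [apply: Au | apply: Av].
Qed.

End Subspaces.

(* Bilinearity is registered so that the general linearity lemmas apply. *)
HB.instance Definition _ (F : fieldType) (P : poissonType F) :=
  bilinear_isBilinear.Build F P P P _ _ (@pmul F P) pmul_bilinear.
HB.instance Definition _ (F : fieldType) (P : poissonType F) :=
  bilinear_isBilinear.Build F P P P _ _ (@pbracket F P) pbracket_bilinear.

Section Ideals.
Variables (F : fieldType) (P : poissonType F).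
Implicit Types (N : set P) (x y z u v e : P).

Lemma pbracketC x y : pbracket x y = - pbracket y x.
Proof.
apply/eqP; rewrite -addr_eq0; apply/eqP.
have := pbracketxx (x + y).
by rewrite linearDl !linearDr /= !pbracketxx add0r addr0.
Qed.

Lemma pleibnizr x y z :
  pbracket z (pmul x y) = pmul x (pbracket z y) + pmul y (pbracket z x).
Proof.
by rewrite pbracketC pleibniz (pbracketC y) (pbracketC x) !linearNr -opprD opprK.
Qed.

Lemma pmul_span_mem N x y : N x -> N y -> pmul_span N N (pmul x y).
Proof. by move=> Nx Ny; apply: sub_gen_smallest; exists x => //; exists y. Qed.

Lemma pmul_span_ind N (Q : set P) :
    subspace Q -> (forall a b, N a -> N b -> Q (pmul a b)) ->
  pmul_span N N `<=` Q.
Proof.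
by move=> sQ QN; apply: smallest_sub => // _ [a Na [b Nb <-]]; apply: QN.
Qed.

Lemma square_sub_ideal N : poisson_ideal N -> pmul_span N N `<=` N.
Proof. by case=> sN Nmul _; apply: pmul_span_ind => // a b _; apply: Nmul. Qed.

(** The bracket with a fixed element is a derivation preserving [N], so it
   preserves [N^2]. *)
Lemma square_ideal N : poisson_ideal N -> poisson_ideal (pmul_span N N).
Proof.
move=> [sN Nmul Nbr].
have sJ : subspace (pmul_span N N) by apply: subspace_linear_span.
have [J0 Jlin] := (subspaceP _).1 sJ.
split=> // x; (apply: pmul_span_ind;
  first by apply/subspaceP; split=> [|a u v Ju Jv];
           [rewrite /= linear0r | rewrite /= linearPr; apply: Jlin])
  => a b Na Nb.
- by rewrite pmulA; apply: pmul_span_mem => //; apply: Nmul.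
- by rewrite pleibnizr; apply: (subspaceD sJ);
    apply: pmul_span_mem => //; apply: Nbr.
Qed.

Lemma poisson_idealT : poisson_ideal [set: P].
Proof. by split=> //; apply/subspaceP. Qed.

(** Products of elements of [Fx + N^2] fall into [N^2] because [N] contains
   [Fx + N^2], and brackets do because [[x, x] = 0] and [N^2] is a Poisson
   ideal. *)
Lemma line_add_square_subalgebra N x : poisson_ideal N -> N x ->
  poisson_subalgebra [set a *: x + u | a in [set: F] & u in pmul_span N N].
Proof.
move=> idN Nx; have [sN _ _] := idN; have JN := square_sub_ideal idN.
have [sJ _ Jbr] := square_ideal idN; have [J0 Jlin] := (subspaceP _).1 sJ.
have in_square w : pmul_span N N w ->
    [set a *: x + u | a in [set: F] & u in pmul_span N N] w.
  by move=> Jw; exists 0 => //; exists w; rewrite // scale0r add0r.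
split.
- apply/subspaceP; split=> [|c _ _ [a _ [u Ju <-]] [b _ [v Jv <-]]].
    exact: in_square.
  exists (c * a + b) => //; exists (c *: u + v); first exact: Jlin.
  by rewrite scalerDr scalerDl scalerA addrACA.
- move=> _ _ [a _ [u Ju <-]] [b _ [v Jv <-]]; apply: in_square.
  apply: pmul_span_mem;
    by apply: (subspaceD sN); [apply: (subspaceZ _ sN) | apply: JN].
- move=> _ _ [a _ [u Ju <-]] [b _ [v Jv <-]]; apply: in_square.
  rewrite linearDr linearZr_LR /= linearDl linearZl_LR /= pbracketxx.
  rewrite scaler0 add0r (pbracketC u).
  apply: (subspaceD sJ); last exact: Jbr.
  apply: (subspaceZ _ sJ); rewrite -scaleN1r.
  by apply: (subspaceZ _ sJ); apply: Jbr.
Qed.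

(** A Lie algebra all of whose lines are ideals is abelian; here the Lie algebra
   is [N / N^2]. *)
Lemma dedekind_bracket_in_square N x y : dedekind P -> poisson_ideal N ->
  N x -> N y -> pmul_span N N (pbracket x y).
Proof.
move=> hP idN Nx Ny; have [sJ _ Jbr] := square_ideal idN.
have [_ _ /(_ y x)] := hP _ (line_add_square_subalgebra idN Nx).
case=> [|a _ [u Ju def_yx]].
  by exists 1 => //; exists 0; [have [] := (subspaceP _).1 sJ
                               | rewrite scale1r addr0].
have [_ _ /(_ x y)] := hP _ (line_add_square_subalgebra idN Ny).
case=> [|b _ [v Jv def_xy]].
  by exists 1 => //; exists 0; [have [] := (subspaceP _).1 sJ
                               | rewrite scale1r addr0].
rewrite pbracketC -scaleN1r; apply: (subspaceZ _ sJ).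
have [a0|a_neq0] := eqVneq a 0; first by rewrite -def_yx a0 scale0r add0r.
have def_ax : a *: x = (-b) *: y - (v + u).
  apply: (addIr u); rewrite def_yx pbracketC -def_xy scaleNr.
  by rewrite !opprD addrA addrNK.
rewrite -[pbracket y x](scalerK a_neq0); apply: (subspaceZ _ sJ).
rewrite -linearZr_LR def_ax linearBr linearZr_LR /= pbracketxx scaler0 add0r.
by rewrite -scaleN1r; apply: (subspaceZ _ sJ); apply: Jbr; apply: (subspaceD sJ).
Qed.

Lemma dedekind_idempotent_line_ideal e : dedekind P -> pmul e e = e ->
  poisson_ideal [set x | exists a : F, x = a *: e].
Proof.
move=> hP ee; apply: hP; split=> [|_ _ [a ->] [b ->]|_ _ [a ->] [b ->]].
- apply/subspaceP; split; first by exists 0; rewrite scale0r.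
  move=> c _ _ [a ->] [b ->]; exists (c * a + b).
  by rewrite scalerDl scalerA.
- by exists (b * a); rewrite linearZr_LR linearZl_LR /= ee scalerA.
- by exists 0; rewrite linearZr_LR linearZl_LR /= pbracketxx !scaler0 scale0r.
Qed.

(** The bracket [[y, e]] is a multiple [c e], and the Leibniz rule for
   [e = e e] gives [c e = c e + c e]. *)
Lemma dedekind_idempotent_central e y :
  dedekind P -> pmul e e = e -> pbracket y e = 0.
Proof.
move=> hP ee; have [_ _ /(_ y e)] := dedekind_idempotent_line_ideal hP ee.
case=> [|c def_ye]; first by exists 1; rewrite scale1r.
have := pleibnizr e e y; rewrite ee def_ye linearZr_LR /= ee.
by move/eqP; rewrite -subr_eq subrr => /eqP <-.
Qed.

Lemma dedekind_annihilator_ideal e :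
  dedekind P -> pmul e e = e -> poisson_ideal [set x | pmul e x = 0].
Proof.
move=> hP ee; split=> [|x y /= ey0|x y /= ey0].
- apply/subspaceP; split=> [|a u v /= eu0 ev0]; first by rewrite /= linear0r.
  by rewrite linearPr /= eu0 ev0 scaler0 addr0.
- by rewrite pmulA (pmulC e) -pmulA ey0 linear0r.
- have := pleibnizr e y x.
  by rewrite ey0 linear0r (dedekind_idempotent_central x hP ee) linear0r addr0.
Qed.

(** The component in the annihilator of [e] is [y - e y], and [e y] lies in
   [F e], which is Lie-central. *)
Lemma dedekind_annihilator_component e y : dedekind P -> pmul e e = e ->
  exists n, pmul e n = 0 /\ forall x, pbracket x n = pbracket x y.
Proof.
move=> hP ee; exists (y - pmul e y); split=> [|x].
  by rewrite linearBr /= pmulA ee subrr.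
have [_ /(_ y e) + _] := dedekind_idempotent_line_ideal hP ee.
case=> [|c def_ye]; first by exists 1; rewrite scale1r.
rewrite pmulC def_ye linearBr linearZr_LR /= (dedekind_idempotent_central x hP ee).
by rewrite scaler0 subr0.
Qed.

End Ideals.

Theorem proposition5p2 (F : fieldType) (P : poissonType F) (E N : set P)
    (hP : dedekind P) (hEN : idempotent_nil_decomposition E N) :
  [/\ poisson_ideal N,
      pbracket_span [set: P] [set: P] = pbracket_span N N &
      pbracket_span N N `<=` pmul_span N N].
Proof.
have [idN compN] : poisson_ideal N /\
    forall y, exists n, N n /\ forall x, pbracket x n = pbracket x y.
  case: hEN => [[_ [_ ->]]|[e [[_ ee] _ ->]]].
    by split=> [|y]; [apply: poisson_idealT | exists y].
  by split=> [|y]; [apply: dedekind_annihilator_ideal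
                   | apply: dedekind_annihilator_component].
split=> //.
- rewrite /pbracket_span; congr linear_span.
  apply/seteqP; split=> [_ [x _ [y _ <-]]|_ [x _ [y _ <-]]]; last first.
    by exists x => //; exists y.
  have [m [Nm brm]] := compN x; have [n [Nn brn]] := compN y.
  exists m => //; exists n => //.
  by rewrite brn pbracketC brm -pbracketC.
- apply: smallest_sub => [|_ [x Nx [y Ny <-]]]; first exact: subspace_linear_span.
  exact: dedekind_bracket_in_square.
Qed.
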